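(* Let $N\subset M$ be a finite index inclusion of type $\mathrm{II}_1$ factors, let $P,Q$ be intermediate subfactors, both different from $N$, and let $\{\lambda_i\}$ (resp. $\{\mu_j\}$) be a Pimsner–Popa basis for $P/N$ (resp. $Q/N$). Then the following are equivalent: (1) $\alpha^N_M(P,Q)=\pi/2$; (2) $q:=\sum_{i,j}\mu_j\lambda_ie_1\lambda_i^*\mu_j^*$ is a projection such that $q\ge e_P$; (3) $p:=\sum_{i,j}\lambda_i\mu_je_1\mu_j^*\lambda_i^*$ is a projection such that $p\ge e_Q$.
   Context: $M_1=\langle M,e_1\rangle$ is the Jones basic construction of $N\subset M$ on $L^2(M)$, $e_1$ being the orthogonal projection of $L^2(M)$ onto $L^2(N)$, and $tr$ is the normalized trace of $M_1$. For an intermediate subfactor $P$, $e_P\in N'\cap M_1$ is the orthogonal projection of $L^2(M)$ onto $L^2(P)$. For $P\neq N$ put $v_P=\frac{e_P-e_1}{\|e_P-e_1\|_2}$, where $\langle x,y\rangle=tr(y^*x)$ and $\|x\|_2=tr(x^*x)^{1/2}$. For $P,Q\ne N$ the angle is $\alpha^N_M(P,Q)=\cos^{-1}\langle v_P,v_Q\rangle$. A Pimsner–Popa basis (right basis, not necessarily orthonormal) for a finite index subfactor $A\subset B$, called a basis for $B/A$, is a finite set $\{\lambda_i\}\subset B$ such that $x=\sum_i\lambda_iE^B_A(\lambda_i^*x)$ for all $x\in B$, where $E^B_A$ is the trace-preserving conditional expectation; equivalently $\sum_i\lambda_ie_A\lambda_i^*=1$ with $e_A$ the projection of $L^2(B)$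 onto $L^2(A)$. *)

(* Defs.v *)
From HB Require Import structures.
From mathcomp Require Import all_boot all_order all_algebra complex.
From mathcomp Require Import all_classical all_reals all_analysis.
Set Implicit Arguments.
Unset Strict Implicit.
Unset Printing Implicit Defensive.
Import Order.TTheory GRing.Theory Num.Theory.
Import numFieldNormedType.Exports.
Local Open Scope classical_set_scope.
Local Open Scope ring_scope.
Local Open Scope complex_scope.

(* The inner product is linear in its first argument. *)
HB.mixin Record CompleteNormedModule_isHilbert (R : realType) H
    & CompleteNormedModule R[i] H := {
  inner : {dot H for (@Num.conj R[i])};
  inner_norm : forall x : H, `|x| ^+ 2 = inner x x
}.
#[short(type="hilbertType")]
HB.structure Definition Hilbert (R : realType) :=
  { H of CompleteNormedModule_isHilbert R H & CompleteNormedModule R[i] H }.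

Section Operators.
Context {R : realType} {H : hilbertType R}.
Implicit Types (S T : H -> H) (A : set (H -> H)).

(* Operators are plain functions, so that equality of operators is equality of
   functions; the predicates below carry their boundedness. *)
Definition bounded_op : set (H -> H) := [set T | linear T /\ continuous T].

(* For bounded T the vector z exists (Riesz) and is unique; the default value 0
   is never used in that case. *)
Definition adj T : H -> H :=
  fun y => xget 0 [set z | forall x, inner (T x) y = inner x z].

Definition op_le S T := forall x, 0 <= inner ((T - S) x) x.

Definition self_adjoint T := bounded_op T /\ adj T = T.

Definition projection T := self_adjoint T /\ T \o T = T.

(* Orthogonal projection onto a closed subspace V. *)
Definition proj_on (V : set H) : H -> H :=
  fun x => xget 0 [set y | V y /\ forall v, V v -> inner (x - y) v = 0].

Definition commutant A : set (H -> H) :=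
  [set T | bounded_op T /\ forall S, A S -> S \o T = T \o S].

Definition von_neumann A :=
  (forall T, A T -> A (adj T)) /\ commutant (commutant A) = A.

Definition factor A :=
  A `&` commutant A = [set T | exists c : R[i], T = c *: idfun].

Definition infinite_dimensional A :=
  ~ exists (n : nat) (b : 'I_n -> H -> H),
      forall T, A T -> exists c : 'I_n -> R[i], T = \sum_i c i *: b i.

(* Suprema of upward directed families of self-adjoint operators. *)
Definition directed (D : set (H -> H)) :=
  D !=set0 /\
  forall S T, D S -> D T -> exists U, [/\ D U, op_le S U & op_le T U].

Definition op_sup A (D : set (H -> H)) T :=
  [/\ A T /\ self_adjoint T,
      forall S, D S -> op_le S T
    & forall U, A U -> self_adjoint U ->
        (forall S, D S -> op_le S U) -> op_le T U].

(* Faithful normal tracial states of the von Neumann algebra A; on a finite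
   factor there is exactly one. Values of tau outside A are irrelevant. *)
Record normalized_trace A (tau : (H -> H) -> R[i]) : Prop := {
  trace_linear : forall (c : R[i]) S T, A S -> A T ->
    tau (c *: S + T) = c * tau S + tau T;
  trace_unit : tau idfun = 1;
  trace_pos : forall T, A T -> 0 <= tau (adj T \o T);
  trace_comm : forall S T, A S -> A T -> tau (S \o T) = tau (T \o S);
  trace_faithful : forall T, A T -> tau (adj T \o T) = 0 -> T = 0;
  trace_normal : forall (D : set (H -> H)) T,
    D `<=` A `&` self_adjoint -> directed D -> op_sup A D T ->
    forall c : R[i], (forall S, D S -> tau S <= c) -> tau T <= c
}.

Definition II1_factor A :=
  [/\ von_neumann A, factor A, infinite_dimensional A
    & exists tau, normalized_trace A tau].

Definition intermediate_subfactor (N M P : set (H -> H)) :=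
  [/\ von_neumann P, factor P, N `<=` P & P `<=` M].

Definition vector_state (Omega : H) : (H -> H) -> R[i] :=
  fun T => inner (T Omega) Omega.

Definition L2 (Omega : H) A : set H := closure [set T Omega | T in A].

(* H is L^2(M): M acts by left multiplication, Omega is the image of 1, and the
   vector state of Omega is the trace of M. *)
Definition standard_form (M : set (H -> H)) (Omega : H) :=
  normalized_trace M (vector_state Omega) /\ L2 Omega M = setT.

(* e_P; the Jones projection e_1 is e_N. *)
Definition jones_proj (Omega : H) (P : set (H -> H)) : H -> H :=
  proj_on (L2 Omega P).

Definition basic_construction (Omega : H) (N M : set (H -> H)) :=
  commutant (commutant (M `|` [set jones_proj Omega N])).

Definition the_trace A : (H -> H) -> R[i] :=
  xget (fun=> 0) (normalized_trace A).

(* The Murray-von Neumann dimension dim_A(H) of H as a module over the finite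
   factor A: tr_A([A' xi]) / tr_{A'}([A xi]), independent of the nonzero
   vector xi, if A' is finite, and +oo otherwise. *)
Definition coupling_constant A (xi : H) : \bar R :=
  if `[< exists tau, normalized_trace (commutant A) tau >] then
    (complex.Re (the_trace A (proj_on (L2 xi (commutant A)))
                 / the_trace (commutant A) (proj_on (L2 xi A))))%:E
  else +oo%E.

(* [M : N] = dim_N(L^2(M)); M enters only through H = L^2(M). *)
Definition jones_index (Omega : H) (N : set (H -> H)) : \bar R :=
  coupling_constant N Omega.

(* E is the tau-preserving conditional expectation of B onto A. *)
Record conditional_expectation (A B : set (H -> H)) (tau : (H -> H) -> R[i])
    (E : (H -> H) -> H -> H) : Prop := {
  ce_in : forall T, B T -> A (E T);
  ce_linear : forall (c : R[i]) S T, B S -> B T ->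
    E (c *: S + T) = c *: E S + E T;
  ce_id : forall T, A T -> E T = T;
  ce_bimod : forall S T U, A S -> B T -> A U ->
    E (S \o T \o U) = S \o E T \o U;
  ce_pos : forall T, B T -> op_le 0 (E (adj T \o T));
  ce_trace : forall T, B T -> tau (E T) = tau T
}.

(* The conditional expectation is unique, so the existential only names it. *)
Definition pimsner_popa_basis (Omega : H) (A B : set (H -> H)) (n : nat)
    (lambda : 'I_n -> H -> H) :=
  (forall i, B (lambda i)) /\
  exists2 E, conditional_expectation A B (vector_state Omega) E
    & forall T, B T -> T = \sum_i (lambda i \o E (adj (lambda i) \o T)).

Definition trace_inner (tr : (H -> H) -> R[i]) S T : R[i] := tr (adj T \o S).

Definition trace_norm (tr : (H -> H) -> R[i]) T : R[i] :=
  sqrtC (tr (adj T \o T)).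

Definition angle_vector (Omega : H) (tr : (H -> H) -> R[i])
    (N P : set (H -> H)) : H -> H :=
  let d := jones_proj Omega P - jones_proj Omega N in (trace_norm tr d)^-1 *: d.

(* The inner product of v_P and v_Q is a nonnegative real number, so Re only
   changes its type. *)
Definition angle (Omega : H) (tr : (H -> H) -> R[i]) (N P Q : set (H -> H)) : R :=
  acos (complex.Re (trace_inner tr (angle_vector Omega tr N P)
                                   (angle_vector Omega tr N Q))).

End Operators.

(* Main.v *)
(* If b is a basis of B over N, then e_B = sum b e_1 b^*, so q = sum mu e_P mu^*.
   The angle is pi/2 iff tr((e_Q - e_1)(e_P - e_1)) = 0, i.e., by faithfulness
   of tr, iff e_P e_Q = e_1 (a commuting square). In that case
   e_P x e_P = E(x) e_P for x in Q, E being the expectation onto N, and the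
   reconstruction formula of the basis mu gives q^2 = q and q e_P = e_P.
   Conversely, sum ||(e_P - e_1) mu^* Omega||^2 = <q Omega, Omega> - 1, which is
   nonpositive when q is a projection, so e_P and e_1 agree on mu^* Omega; both
   commute with N, hence they agree on Q Omega = N mu^* Omega. *)
Require Import Defs.
From mathcomp Require Import all_boot all_order all_algebra complex.
From mathcomp Require Import all_classical all_reals all_analysis.
From mathcomp Require Import ring.
Set Implicit Arguments.
Unset Strict Implicit.
Unset Printing Implicit Defensive.
Import Order.TTheory GRing.Theory Num.Theory.
Import numFieldNormedType.Exports.
Local Open Scope classical_set_scope.
Local Open Scope ring_scope.

(** * Hilbert spaces *)

Section Hilbert.
Context {R : realType} {H : hilbertType R}.
Local Notation C := (R[i]%C).
Implicit Types (x y z u v w : H) (V W : set H) (S T : H -> H) (a c e : C).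

Lemma innerDl x y z : inner (x + y) z = inner x z + inner y z.
Proof. exact: linearDl. Qed.
Lemma innerBl x y z : inner (x - y) z = inner x z - inner y z.
Proof. exact: linearBl. Qed.
Lemma innerBr x y z : inner x (y - z) = inner x y - inner x z.
Proof. exact: linearBr. Qed.
Lemma innerZl c x y : inner (c *: x) y = c * inner x y.
Proof. exact: linearZl_LR. Qed.
Lemma innerZr c x y : inner x (c *: y) = c^* * inner x y.
Proof. exact: linearZr_LR. Qed.
Lemma inner0l x : inner 0 x = 0.
Proof. exact: linear0l. Qed.
Lemma inner0r x : inner x 0 = 0.
Proof. exact: linear0r. Qed.
Lemma inner_suml n (f : 'I_n -> H) x :
  inner (\sum_i f i) x = \sum_i inner (f i) x.
Proof. by apply: (big_morph (inner^~ x)) => [y z|]; rewrite ?innerDl ?inner0l. Qed.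
Lemma inner_sumr n (f : 'I_n -> H) x :
  inner x (\sum_i f i) = \sum_i inner x (f i).
Proof. exact: linear_sumr. Qed.
Lemma innerC x y : inner x y = (inner y x)^*.
Proof. by have := @hermitian_subproof _ _ _ _ inner x y; rewrite mul1r. Qed.

Lemma inner_ge0 x : 0 <= inner x x :> C.
Proof. by rewrite -inner_norm exprn_ge0. Qed.

Lemma inner_eq0 x : inner x x = 0 -> x = 0.
Proof.
move/eqP; rewrite -inner_norm expf_eq0 /= normr_eq0.
by move/eqP.
Qed.

Lemma inner_ext x y : (forall z, inner x z = inner y z) -> x = y.
Proof.
move=> xy; apply/eqP; rewrite -subr_eq0; apply/eqP/inner_eq0.
by rewrite innerBl xy subrr.
Qed.

Lemma inner0C x y : inner x y = 0 -> inner y x = 0.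
Proof. by move=> xy; rewrite innerC xy conjC0. Qed.

(** Pythagoras for [x] split along [y] and its orthogonal complement. Dropping the first term gives
    Cauchy-Schwarz; bounding it below by a distance gives [almost_orthogonal]. *)
Lemma inner_decomp x y : y != 0 ->
  inner x x = inner (x - (inner x y / inner y y) *: y)
                    (x - (inner x y / inner y y) *: y)
              + `|inner x y| ^+ 2 / inner y y.
Proof.
move=> y0; have yy0 : inner y y != 0 :> C.
  by apply: contra_neq y0 => /inner_eq0.
rewrite innerBl !innerBr !innerZl !innerZr (innerC y x) normCK rmorphM fmorphV.
have cyy : (inner y y)^* = inner y y by rewrite -innerC.
by rewrite /= in cyy *; rewrite cyy; field.
Qed.

Lemma cauchy_schwarz x y : `|inner x y| <= `|x| * `|y|.
Proof.
have [->|y0] := eqVneq y 0; first by rewrite inner0r !normr0 mulr0.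
have yy : 0 < inner y y :> C.
  rewrite lt_def inner_ge0 andbT; apply: contra_neq y0 => /inner_eq0 //.
rewrite -(@ler_pXn2r _ 2) ?nnegrE ?mulr_ge0// exprMn !inner_norm.
by rewrite -ler_pdivrMr// (inner_decomp x y0) lerDr inner_ge0.
Qed.

Definition is_subspace V := V 0 /\ forall c x y, V x -> V y -> V (c *: x + y).

Lemma subspaceB V x y : is_subspace V -> V x -> V y -> V (x - y).
Proof.
by move=> [V0 Vl] Vx Vy; rewrite addrC -scaleN1r; apply: Vl.
Qed.

Lemma distance_inf V x : V !=set0 -> exists2 d : C,
  forall v, V v -> d <= inner (x - v) (x - v)
  & forall e, 0 < e -> exists2 v, V v & inner (x - v) (x - v) < d + e.
Proof.
(* The order on [R[i]] is partial, so the infimum is taken over the real parts and then embedded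
   back. *)
move=> [v0 Vv0]; pose f v : R := complex.Re (inner (x - v) (x - v)).
have fE v : inner (x - v) (x - v) = (f v)%:C%C.
  by rewrite RRe_real// ger0_real// inner_ge0.
have f_ge0 v : 0 <= f v.
  by have := inner_ge0 (x - v); rewrite fE lecR.
have hi : has_inf (f @` V).
  split; first by exists (f v0), v0.
  by exists 0 => _ [v _ <-].
exists (inf (f @` V))%:C%C => [v Vv|e e0].
  by rewrite fE lecR; apply: ge_inf; [case: hi|exists v].
have eE : e = (complex.Re e)%:C%C by rewrite RRe_real// gtr0_real.
have re0 : 0 < complex.Re e by rewrite -ltcR -eE.
have [_ [v Vv <-] lev] := inf_adherent re0 hi.
by exists v => //; rewrite fE eE -rmorphD ltcR.
Qed.


(** Take [v] whose squared distance to [x] exceeds the infimum by less than [s ^+ 2]. Moving [v]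
    optimally along [u] lowers that squared distance by [|<x - v, u>|^2 / |u|^2], which therefore
    cannot exceed [s ^+ 2]. *)
Lemma almost_orthogonal V x s : is_subspace V -> 0 < s ->
  exists2 v, V v & forall u, V u -> `|inner (x - v) u| <= s * `|u|.
Proof.
move=> [V0 Vl] s0; have [d dmin dinf] := @distance_inf V x (ex_intro _ 0 V0).
have [v Vv xv] := dinf (s ^+ 2) (exprn_gt0 2 s0).
exists v => // u Vu; have [->|u0] := eqVneq u 0.
  by rewrite inner0r !normr0 mulr0.
have uu : 0 < inner u u :> C.
  by rewrite lt_def inner_ge0 andbT; apply: contra_neq u0 => /inner_eq0.
rewrite -(@ler_pXn2r _ 2) ?nnegrE ?mulr_ge0 ?(ltW s0)// exprMn !inner_norm.
rewrite -ler_pdivrMr// -(lerD2l d) (le_trans _ (ltW xv))//.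
rewrite (inner_decomp (x - v) u0) lerD2r.
(* The remainder is [x] minus the point [v + c *: u] of [V], so its squared norm is at least [d]. *)
set c := (X in X *: u); rewrite -addrA -opprD; apply: dmin.
by rewrite addrC; apply: Vl.
Qed.

(** Both hypotheses are tested on [u = v - w]: the difference of the two inner products has modulus
    [|v - w|^2], and one factor [|v - w|] cancels. *)
Lemma almost_orthogonal_close V x v w s t : is_subspace V ->
  0 < s -> 0 < t -> V v -> V w ->
  (forall u, V u -> `|inner (x - v) u| <= s * `|u|) ->
  (forall u, V u -> `|inner (x - w) u| <= t * `|u|) ->
  `|v - w| <= s + t.
Proof.
move=> sV s0 t0 Vv Vw xv xw; have Vu := subspaceB sV Vv Vw.
have [->|u0] := eqVneq (v - w) 0; first by rewrite normr0 addr_ge0// ltW.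
have := lerD (xv _ Vu) (xw _ Vu); rewrite -mulrDl => /(le_trans (ler_normB _ _)).
rewrite -innerBl opprB addrC addrA addrNK -opprB -scaleN1r innerZl normrM.
rewrite normrN1 mul1r -inner_norm normrX normr_id expr2 ler_pM2r//.
by rewrite normr_gt0.
Qed.

Lemma ler_eps_eq0 (a b : C) : 0 <= a -> 0 <= b ->
  (forall e, 0 < e -> a <= e * b) -> a = 0.
Proof.
move=> a0 b0 ab; apply/eqP; rewrite -[_ == _]negbK; apply/negP => an0.
have a_gt0 : 0 < a by rewrite lt_def an0.
have b_gt0 : 0 < b.
  rewrite lt_def b0 andbT; apply: contraL (ab 1 ltr01) => /eqP ->.
  by rewrite mulr0 lt_geF.
(* This choice of [e] would give [a <= a / 2]. *)
have := ab (a / (2 * b)); rewrite divr_gt0 ?mulr_gt0// => /(_ isT).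
rewrite invfM mulrA mulfVK ?gt_eqF// lt_geF//.
by rewrite ltr_pdivrMr// mulrDr mulr1 ltrDl.
Qed.

(* Near-minimizers of the distance to x are almost orthogonal to V, which makes
   the filter of near-minimizers Cauchy without the parallelogram law. *)
Theorem projection_theorem V x : is_subspace V -> closed V ->
  exists y, V y /\ forall v, V v -> inner (x - y) v = 0.
Proof.
move=> sV cV; pose A (s : C) := [set v | V v /\
  forall u, V u -> `|inner (x - v) u| <= s * `|u|].
pose F := filter_from [set s : C | 0 < s] A.
have AS s t : s <= t -> A s `<=` A t.
  move=> st v [Vv vs]; split=> // u /vs /le_trans; apply.
  by rewrite ler_wpM2r.
have FF : ProperFilter F.
  apply: filter_from_proper; last first.
    by move=> s s0; have [v Vv vs] := almost_orthogonal x sV s0; exists v.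
  apply: filter_from_filter; first by exists 1 => /=.
  (* Positive elements of [R[i]] are real, hence comparable, and the sets [A s] increase with
     [s]. *)
  move=> s t s0 t0; have /orP[st|ts] := real_leVge (gtr0_real s0) (gtr0_real t0).
    by exists s => // v sv; split => //; apply: AS st _ sv.
  by exists t => // v tv; split => //; apply: AS ts _ tv.
have Fc : cauchy F.
  (* Two points of [A (e / 4)] are at distance at most [e / 2], which is strictly below [e]. *)
  apply: cauchy_exP => e e0; have e4 : 0 < e / 4 by rewrite divr_gt0.
  have [v Vv vs] := almost_orthogonal x sV e4.
  exists v; exists (e / 4) => // w [Vw ws].
  rewrite -ball_normE /=.
  apply: le_lt_trans (almost_orthogonal_close sV e4 e4 Vv Vw vs ws) _.
  by rewrite -mulrDl ltr_pdivrMr// -mulr2n -[e *+ 2]mulr_natr ltr_pM2l// ltr_nat.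
have Fy := cauchy_cvg F Fc; set y := lim F in Fy.
have near_y e : 0 < e -> exists2 v, A e v & `|y - v| < e.
  move=> e0; have Fe : F (A e) by exists e.
  have By : F (ball y e) by apply: Fy; apply: nbhsx_ballx.
  have [v [Av]] := filter_ex (filterI Fe By).
  by rewrite -ball_normE => ?; exists v.
exists y; split.
  rewrite (closure_id V).1// => B /nbhs_ballP[e /= e0 eB].
  have [v [Vv _] yv] := near_y e e0.
  by exists v; split => //; apply: eB; rewrite -ball_normE.
move=> u Vu; apply/eqP; rewrite -normr_eq0; apply/eqP.
apply: (@ler_eps_eq0 _ (2 * `|u|)) => [||e e0]; rewrite ?mulr_ge0//.
have [v [Vv xv] yv] := near_y e e0.
have -> : inner (x - y) u = inner (x - v) u - inner (y - v) u :> C.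
  by rewrite -innerBl opprB addrA addrNK.
rewrite (le_trans (ler_normB _ _))// mulrCA mulr_natl mulr2n lerD ?xv//.
by rewrite (le_trans (cauchy_schwarz _ _))// ler_wpM2r// ltW.
Qed.

Lemma closure_subspace V : is_subspace V -> is_subspace (closure V).
Proof.
move=> [V0 Vl]; split; first exact: subset_closure.
move=> c x y Vx Vy B /nbhs_ballP[e /= e0 eB].
(* Chosen so that the errors [|c| * d] and [d] add up to [e]; the summand 1 keeps the denominator
   positive when [c = 0]. *)
pose d := e / (`|c| + 1).
have c1 : 0 < `|c| + 1 by rewrite ltr_wpDl.
have d0 : 0 < d by rewrite divr_gt0.
have [x' [Vx' xx']] := Vx _ (nbhsx_ballx x d d0).
have [y' [Vy' yy']] := Vy _ (nbhsx_ballx y d d0).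
exists (c *: x' + y'); split; first exact: Vl.
apply: eB; move: xx' yy'; rewrite -ball_normE /= => xx' yy'.
rewrite opprD addrACA -scalerBr (le_lt_trans (ler_normD _ _))// normrZ.
have -> : e = `|c| * d + d.
  by rewrite -[X in _ + X]mul1r -mulrDl mulrCA mulfV ?mulr1// gt_eqF.
by rewrite ler_ltD// ler_wpM2l// ltW.
Qed.

Lemma closure_ortho V z : (forall v, V v -> inner v z = 0) ->
  forall v, closure V v -> inner v z = 0.
Proof.
move=> zV v vV; apply/eqP; rewrite -normr_eq0; apply/eqP.
apply: (@ler_eps_eq0 _ `|z|) => // e e0.
have [w [/zV Vw]] := vV _ (nbhsx_ballx v e e0); rewrite -ball_normE /= => vw.
have -> : inner v z = inner (v - w) z by rewrite innerBl Vw subr0.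
by rewrite (le_trans (cauchy_schwarz _ _))// ler_wpM2r// ltW.
Qed.

End Hilbert.

(** * Orthogonal projections onto closed subspaces *)

Section Projections.
Context {R : realType} {H : hilbertType R}.
Local Notation C := (R[i]%C).
Implicit Types (x y z u v w : H) (V W : set H).

(** Two candidates differ by a vector that lies in [V] and is orthogonal to [V], so the choice made
    by [xget] is forced. *)
Lemma proj_on_eq V x y : is_subspace V -> V y ->
  (forall v, V v -> inner (x - y) v = 0) -> proj_on V x = y.
Proof.
move=> sV Vy xy; rewrite /proj_on; case: xgetP => [z _ [Vz xz]|/(_ y)]; last first.
  by case.
apply/eqP; rewrite -subr_eq0; apply/eqP/inner_eq0.
have Vzy := subspaceB sV Vz Vy.
rewrite {1}[z - y](_ : _ = (x - y) - (x - z)); last first.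
  by rewrite opprB [RHS]addrC addrA addrNK.
by rewrite innerBl xy// xz// subrr.
Qed.

Section ClosedSubspace.
Variable V : set H.
Hypotheses (sV : is_subspace V) (cV : closed V).

Lemma proj_onP x :
  V (proj_on V x) /\ forall v, V v -> inner (x - proj_on V x) v = 0.
Proof.
have [y [Vy xy]] := projection_theorem x sV cV.
by rewrite (proj_on_eq sV Vy xy).
Qed.

Lemma proj_on_in x : V (proj_on V x).
Proof. by case: (proj_onP x). Qed.

Lemma proj_on_id x : V x -> proj_on V x = x.
Proof. by move=> Vx; apply: proj_on_eq => // v _; rewrite subrr inner0l. Qed.

Lemma proj_on_innerl x v : V v -> inner (proj_on V x) v = inner x v.
Proof.
by move=> Vv; apply/esym/eqP; rewrite -subr_eq0 -innerBl (proj_onP x).2.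
Qed.

Lemma proj_on_innerr x v : V v -> inner v (proj_on V x) = inner v x.
Proof. by move=> Vv; rewrite innerC proj_on_innerl// -innerC. Qed.

Lemma proj_on_herm x y : inner (proj_on V x) y = inner x (proj_on V y).
Proof.
by rewrite -proj_on_innerr ?proj_on_innerl//; exact: proj_on_in.
Qed.

(** Symmetry moves the projection to the other argument of the inner product, where linearity in the
    first one applies. *)
Lemma proj_on_linear : linear (proj_on V).
Proof.
move=> c x y; apply: inner_ext => z.
by rewrite proj_on_herm !innerDl !innerZl !proj_on_herm.
Qed.

Lemma proj_on_norm x : `|proj_on V x| <= `|x|.
Proof.
have [->|p0] := eqVneq (proj_on V x) 0; first by rewrite normr0.
have p_gt0 : 0 < `|proj_on V x| by rewrite normr_gt0.
rewrite -(ler_pM2r p_gt0) -expr2 inner_norm proj_on_innerl; last exact: proj_on_in.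
apply: le_trans (cauchy_schwarz _ _).
by rewrite real_ler_norm// -proj_on_innerl ?ger0_real ?inner_ge0//; exact: proj_on_in.
Qed.

Lemma proj_on_bounded : bounded_op (proj_on V).
Proof.
split; first exact: proj_on_linear.
move=> x; apply/cvgrPdist_lt => e e0; near=> y.
have -> : proj_on V x - proj_on V y = proj_on V (x - y).
  by rewrite addrC -scaleN1r -proj_on_linear scaleN1r addrC.
apply: le_lt_trans (proj_on_norm _) _; near: y.
exact: cvgr_dist_lt.
Unshelve. all: by end_near. Qed.

End ClosedSubspace.

Lemma proj_on_sub V W x : is_subspace V -> closed V -> is_subspace W -> closed W ->
  V `<=` W -> proj_on V (proj_on W x) = proj_on V x /\
              proj_on W (proj_on V x) = proj_on V x.
Proof.
move=> sV cV sW cW VW; split; last first.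
  by apply: proj_on_id => //; apply: VW; exact: proj_on_in.
apply: inner_ext => y; rewrite !proj_on_herm// proj_on_id//.
by apply: VW; exact: proj_on_in.
Qed.

End Projections.

(** * Bounded operators, the Riesz theorem and adjoints *)

Section Operators.
Context {R : realType} {H : hilbertType R}.
Local Notation C := (R[i]%C).
Implicit Types (x y z u v w : H) (V W : set H) (S T : H -> H) (c e : C).

Lemma linearDE T x y : linear T -> T (x + y) = T x + T y.
Proof. by move=> /(_ 1 x y); rewrite !scale1r. Qed.

Lemma linear0E T : linear T -> T 0 = 0.
Proof. by move=> /(_ (-1) 0 0); rewrite !scaleN1r !addNr. Qed.

Lemma linearZE T c x : linear T -> T (c *: x) = c *: T x.
Proof. by move=> lT; have := lT c x 0; rewrite !addr0 linear0E// addr0. Qed.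

Lemma linearBE T x y : linear T -> T (x - y) = T x - T y.
Proof. by move=> lT; rewrite -[- y]scaleN1r linearDE// linearZE// scaleN1r. Qed.

Lemma linear_sumE T n (f : 'I_n -> H) :
  linear T -> T (\sum_i f i) = \sum_i T (f i).
Proof.
by move=> lT; apply: big_morph => [x y|]; rewrite ?linearDE ?linear0E.
Qed.

Lemma bounded_op_id : bounded_op (idfun : H -> H).
Proof. by split=> [//|x]; exact: cvg_id. Qed.

Lemma bounded_op_comp S T : bounded_op S -> bounded_op T -> bounded_op (S \o T).
Proof.
move=> [lS cS] [lT cT]; split; first by move=> c x y /=; rewrite lT lS.
by move=> x; apply: continuous_comp; [exact: cT|exact: cS].
Qed.

Lemma op_linE c S T x : (c *: S + T) x = c *: S x + T x.
Proof. by []. Qed.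

Lemma bounded_op_lin c S T :
  bounded_op S -> bounded_op T -> bounded_op (c *: S + T).
Proof.
move=> [lS cS] [lT cT]; split.
  move=> a x y; rewrite !op_linE lS lT !scalerDr !scalerA mulrC -!addrA.
  by congr (_ + _); rewrite addrCA.
move=> x; apply: continuousD; last exact: cT.
by apply: continuousZl_tmp; exact: cS.
Qed.

Lemma bounded_op_sum n (f : 'I_n -> H -> H) :
  (forall i, bounded_op (f i)) -> bounded_op (\sum_i f i).
Proof.
move=> bf; elim/big_ind : _ => [|S T bS bT|//].
  split; first by move=> c x y /=; rewrite -[RHS]/(c *: 0 + 0) scaler0 addr0.
  by move=> x; exact: cst_continuous.
by have := bounded_op_lin 1 bS bT; rewrite scale1r.
Qed.

Lemma kernel_closed T z : bounded_op T -> closed [set x | inner (T x) z = 0].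
Proof.
move=> [lT cT] x clx /=.
have clTx : closure [set y | inner y z = 0] (T x).
  by move=> B /cT /clx [y [yz By]]; exists (T y).
exact: (@closure_ortho _ _ [set y | inner y z = 0]) clTx.
Qed.

Lemma kernel_subspace T z : linear T -> is_subspace [set x | inner (T x) z = 0].
Proof.
move=> lT; split=> /= [|c x y xz yz]; first by rewrite linear0E// inner0l.
by rewrite lT innerDl innerZl xz yz mulr0 addr0.
Qed.

(** The functional [x |-> <T x, y>] has a closed kernel [K]. If it is nonzero, the representing
    vector is a multiple of a vector [w] orthogonal to [K]. *)
Theorem riesz T y : bounded_op T -> exists z, forall x, inner (T x) y = inner x z.
Proof.
move=> bT; have [lT _] := bT; pose K := [set x | inner (T x) y = 0].
have sK : is_subspace K by exact: kernel_subspace.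
have cK : closed K by exact: kernel_closed.
have [KT|/existsNP[u Ku]] := pselect (forall x, K x).
  by exists 0 => x; rewrite KT inner0r.
pose w := u - proj_on K u.
have wK v : K v -> inner w v = 0 by exact: (proj_onP sK cK u).2.
have Tw : inner (T w) y != 0.
  apply/eqP => Tw0; apply: Ku.
  have /inner_eq0/eqP : inner w w = 0 by exact: wK.
  by rewrite subr_eq0 => /eqP ->; exact: proj_on_in.
have ww : inner w w != 0.
  by apply: contra_neq Tw => /inner_eq0 ->; rewrite linear0E// inner0l.
exists ((inner (T w) y / inner w w)^* *: w) => x.
rewrite innerZr conjCK.
(* Subtracting this multiple of [w] puts [x] into [K]; pairing the result with [w] then computes
   [inner x w]. *)
have : K (x - (inner (T x) y / inner (T w) y) *: w).
  by rewrite /K /= linearBE// linearZE// innerBl innerZl mulfVK// subrr.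
move=> /wK /inner0C; rewrite innerBl innerZl => /eqP; rewrite subr_eq0 => /eqP ->.
by field; rewrite Tw ww.
Qed.

Lemma adjP T x y : bounded_op T -> inner (T x) y = inner x (adj T y).
Proof.
move=> bT; rewrite /adj; case: xgetP => [z _ ->//|].
by have [z Tz] := riesz y bT => /(_ z).
Qed.

Lemma adjPr T x y : bounded_op T -> inner (adj T x) y = inner x (T y).
Proof. by move=> bT; rewrite innerC -adjP// -innerC. Qed.

Lemma adj_eq S T :
  (forall x y, inner (T x) y = inner x (S y)) -> adj T = S.
Proof.
move=> TS; apply/funext => y; rewrite /adj; case: xgetP => [z _ /= zP|/(_ (S y))].
  by apply: inner_ext => x; rewrite innerC -zP TS -innerC.
by case => x; exact: TS.
Qed.

Lemma adjK T : bounded_op T -> bounded_op (adj T) -> adj (adj T) = T.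
Proof. by move=> bT bT'; apply: adj_eq => x y; exact: adjPr. Qed.

End Operators.

(** * Operator algebras and Jones projections *)

Section OperatorAlgebras.
Context {R : realType} {H : hilbertType R}.
Local Notation C := (R[i]%C).
Implicit Types (x y z u v w : H) (S T U : H -> H) (c e : C).
Implicit Types (A B X : set (H -> H)).

(** The structure shared by von Neumann algebras and the bicommutant that defines the basic
    construction; closure under [adj] is taken from [von_neumann] where it is wanted. *)
Record op_algebra A : Prop := {
  alg_bounded : forall T, A T -> bounded_op T;
  alg_id : A idfun;
  alg_lin : forall c S T, A S -> A T -> A (c *: S + T);
  alg_comp : forall S T, A S -> A T -> A (S \o T)
}.

Lemma alg_linear A T : op_algebra A -> A T -> linear T.
Proof. by move=> aA /(alg_bounded aA)[]. Qed.

Lemma alg0 A : op_algebra A -> A 0.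
Proof.
by move=> aA; have := alg_lin aA (-1) (alg_id aA) (alg_id aA); rewrite scaleN1r addNr.
Qed.

Lemma algB A S T : op_algebra A -> A S -> A T -> A (S - T).
Proof. by move=> aA AS AT; rewrite addrC -scaleN1r; apply: alg_lin. Qed.

Lemma alg_sum A n (f : 'I_n -> H -> H) :
  op_algebra A -> (forall i, A (f i)) -> A (\sum_i f i).
Proof.
move=> aA Af; elim/big_ind : _ => [|S T AS AT|//]; first exact: alg0.
by have := alg_lin aA 1 AS AT; rewrite scale1r.
Qed.

Lemma algebra_commutant X :
  (forall S, X S -> linear S) -> op_algebra (commutant X).
Proof.
move=> lX; split=> [T []//||c S T [bS cS] [bT cT]|S T [bS cS] [bT cT]].
- by split; [exact: bounded_op_id|].
- split; first exact: bounded_op_lin.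
  move=> U XU; apply/funext => x; rewrite /= !op_linE lX//.
  have pt V : U \o V = V \o U -> U (V x) = V (U x).
    by move=> /(congr1 (fun f => f x)).
  by rewrite (pt _ (cS _ XU)) (pt _ (cT _ XU)).
- split; first exact: bounded_op_comp.
  by move=> U XU; rewrite compA cS// -compA cT// compA.
Qed.

Lemma algebra_bicommutant X : op_algebra (commutant (commutant X)).
Proof. by apply: algebra_commutant => S [[]]. Qed.

Lemma sub_bicommutant X T : bounded_op T -> X T -> commutant (commutant X) T.
Proof. by move=> bT XT; split=> // S [_ cS]; rewrite cS. Qed.

Lemma von_neumann_algebra A : von_neumann A -> op_algebra A.
Proof. by move=> [_ <-]; exact: algebra_bicommutant. Qed.

(** * The subspaces [L2 Omega A] and their Jones projections *)

Section L2.
Variable Omega : H.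

Lemma L2_subspace A : op_algebra A -> is_subspace (L2 Omega A).
Proof.
move=> aA; apply: closure_subspace; split.
  by exists 0 => //; exact: alg0.
move=> c _ _ [S AS <-] [T AT <-]; exists (c *: S + T) => //.
exact: alg_lin.
Qed.

Lemma L2_closed A : closed (L2 Omega A).
Proof. exact: closed_closure. Qed.

Lemma L2_in A T : A T -> L2 Omega A (T Omega).
Proof. by move=> AT; apply: subset_closure; exists T. Qed.

Lemma L2_sub A B : A `<=` B -> L2 Omega A `<=` L2 Omega B.
Proof. by move=> AB; apply: closure_subset => _ [T AT <-]; exists T => //; exact: AB. Qed.

Lemma L2_mul A T x : op_algebra A -> A T -> L2 Omega A x -> L2 Omega A (T x).
Proof.
move=> aA AT Ax B /(alg_bounded aA AT).2 /Ax [_ [[S AS <-] BTS]].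
exists (T (S Omega)); split => //; exists (T \o S) => //.
exact: alg_comp.
Qed.

Lemma L2_ortho A z : (forall S, A S -> inner (S Omega) z = 0) ->
  forall v, L2 Omega A v -> inner v z = 0.
Proof. by move=> Az; apply: closure_ortho => _ [S AS <-]; exact: Az. Qed.

Local Notation e_ := (jones_proj Omega).

Section JonesProjection.
Variable A : set (H -> H).
Hypothesis aA : op_algebra A.
Let sA := L2_subspace aA.
Let cA := @L2_closed A.

Lemma jones_in x : L2 Omega A (e_ A x).
Proof. exact: proj_on_in. Qed.

Lemma jones_id x : L2 Omega A x -> e_ A x = x.
Proof. exact: proj_on_id. Qed.

Lemma jonesK x : e_ A (e_ A x) = e_ A x.
Proof. by rewrite jones_id//; exact: jones_in. Qed.

Lemma jones_unit : e_ A Omega = Omega.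
Proof. by apply: jones_id; exact: (L2_in (alg_id aA)). Qed.

Lemma jones_herm x y : inner (e_ A x) y = inner x (e_ A y).
Proof. exact: proj_on_herm. Qed.

Lemma jones_bounded : bounded_op (e_ A).
Proof. exact: proj_on_bounded. Qed.

(** Orthogonality is tested only on the dense vectors [S Omega]; this is the main tool for computing
    [e_ A]. *)
Lemma jones_eq x y : L2 Omega A y ->
  (forall S, A S -> inner (S Omega) (x - y) = 0) -> e_ A x = y.
Proof.
by move=> Ay xy; apply: proj_on_eq => // v Av; apply/inner0C/(L2_ortho xy).
Qed.

Lemma jones_sub B x : op_algebra B -> A `<=` B ->
  e_ A (e_ B x) = e_ A x /\ e_ B (e_ A x) = e_ A x.
Proof.
move=> aB AB; apply: proj_on_sub => //; [exact: L2_subspace|exact: L2_closed|].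
exact: L2_sub.
Qed.

End JonesProjection.

(** Both [T] and [adj T] preserve [L2 Omega A], so [T] also preserves its orthogonal complement. *)
Lemma jones_mul A T x : von_neumann A -> A T -> e_ A (T x) = T (e_ A x).
Proof.
move=> vA AT; have aA := von_neumann_algebra vA; have bT := alg_bounded aA AT.
apply: jones_eq => // [|S AS].
  by apply: L2_mul => //; exact: jones_in.
rewrite innerBr -!(adjPr _ _ bT) -jones_herm// jones_id ?subrr//.
apply: L2_mul => //; first by apply: vA.1.
exact: L2_in.
Qed.

End L2.

(** * Consequences of a tracial vector state *)

Section TraceVector.
Variables (Omega : H) (M : set (H -> H)).
Hypotheses (vM : von_neumann M) (tM : normalized_trace M (vector_state Omega)).
Let aM := von_neumann_algebra vM.
Local Notation e_ := (jones_proj Omega).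

Lemma vector_traceC S T : M S -> M T ->
  inner (S (T Omega)) Omega = inner (T (S Omega)) Omega.
Proof. exact: trace_comm tM _ _. Qed.

Lemma vector_separating T : M T -> T Omega = 0 -> T = 0.
Proof.
move=> MT T0; apply: (trace_faithful tM MT).
rewrite /vector_state /= T0 (linear0E (alg_linear aM _)) ?inner0l//.
exact: vM.1.
Qed.

Section Expectation.
Variables (A B : set (H -> H)) (E : (H -> H) -> H -> H).
Hypotheses (vA : von_neumann A) (vB : von_neumann B).
Hypotheses (AB : A `<=` B) (BM : B `<=` M).
Hypothesis hE : conditional_expectation A B (vector_state Omega) E.
Let aA := von_neumann_algebra vA.
Let aB := von_neumann_algebra vB.

Lemma expectation_mull S T : A S -> B T -> E (S \o T) = S \o E T.
Proof. by move=> AS BT; have := ce_bimod hE AS BT (alg_id aA). Qed.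

(** For [S] in [A], trace preservation applied to [adj S \o T] says that [T Omega - E T Omega] is
    orthogonal to [S Omega]. *)
Lemma jones_expectation T : B T -> e_ A (T Omega) = E T Omega.
Proof.
move=> BT; have AET := ce_in hE BT.
apply: jones_eq => // [|S AS]; first exact: L2_in.
have AS' := vA.1 _ AS; apply: inner0C.
rewrite innerBl -!(adjPr _ _ (alg_bounded aA AS)).
have := ce_trace hE (alg_comp aB (AB AS') BT).
by rewrite expectation_mull// /vector_state /= => ->; rewrite subrr.
Qed.

(** Each [b i] preserves [L2 Omega B], so the sum lies there. Against [S Omega] the two sides agree
    term by term once [S] is expanded in the basis and [E] is replaced by [e_ A] on [B Omega]. *)
Lemma basis_jones n (b : 'I_n -> H -> H) :
  (forall i, B (b i)) ->
  (forall T, B T -> T = \sum_i (b i \o E (adj (b i) \o T))) ->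
  forall x, e_ B x = \sum_i b i (e_ A (adj (b i) x)).
Proof.
move=> Bb bE x; have sB := L2_subspace Omega aB.
have bb i := alg_bounded aB (Bb i).
apply: jones_eq => // [|S BS].
  elim/big_ind : _ => [|y z By Bz|i _]; first exact: sB.1.
    by have := sB.2 1 _ _ By Bz; rewrite scale1r.
  apply: L2_mul => //; apply: (L2_sub AB); exact: jones_in.
rewrite innerBr inner_sumr {1}(bE _ BS) fct_sumE inner_suml -sumrB.
rewrite big1// => i _ /=; rewrite -jones_expectation; last first.
  by apply: alg_comp => //; exact: vB.1.
by rewrite -(adjPr _ _ (bb i)) -jones_herm// (adjP _ _ (bb i)) subrr.
Qed.

End Expectation.
End TraceVector.
End OperatorAlgebras.

(** * Commuting squares *)

Section CommutingSquare.
Context {R : realType} {H : hilbertType R}.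
Local Notation C := (R[i]%C).
Implicit Types (x y z u v w : H) (S T U : H -> H).
Variables (Omega : H) (M N P Q : set (H -> H)).
Hypotheses (vM : von_neumann M) (tM : normalized_trace M (vector_state Omega)).
Hypotheses (vN : von_neumann N) (vP : von_neumann P) (vQ : von_neumann Q).
Hypotheses (NP : N `<=` P) (NQ : N `<=` Q) (PM : P `<=` M) (QM : Q `<=` M).
Let aN := von_neumann_algebra vN.
Let aP := von_neumann_algebra vP.
Let aQ := von_neumann_algebra vQ.
Let aM := von_neumann_algebra vM.
Local Notation e_ := (jones_proj Omega).

(** With [D = T - E T], the commuting square gives [e_P D Omega = 0]. For [S], [U] in [P] the trace
    moves [U] across: [<D U Omega, S Omega> = <D Omega, S U^* Omega>], which vanishes because
    [S U^* Omega] lies in [L2 Omega P]. By density [D] maps [L2 Omega P] into its orthogonal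
    complement. *)
Lemma jones_compression E T x :
  conditional_expectation N Q (vector_state Omega) E ->
  (forall y, e_ P (e_ Q y) = e_ N y) ->
  Q T -> e_ P (T (e_ P x)) = E T (e_ P x).
Proof.
move=> hE sq QT; have NET := ce_in hE QT; have QET := NQ NET.
pose D := - 1 *: E T + T.
have QD : Q D by exact: alg_lin.
have DO : e_ P (D Omega) = 0.
  rewrite -(jones_id aQ (L2_in QD)) sq (jones_expectation vN vQ NQ hE)//.
  by rewrite (ce_linear hE)// (ce_id hE)// scaleN1r addNr.
have PET := NP NET.
apply: jones_eq => // [|S PS].
  by apply: L2_mul => //; exact: jones_in.
have -> : T (e_ P x) - E T (e_ P x) = D (e_ P x).
  by rewrite /D op_linE scaleN1r addrC.
have bD := alg_bounded aQ QD.
rewrite -(adjPr _ _ bD); apply: inner0C; move: (e_ P x) (@jones_in _ _ Omega _ aP x).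
apply: L2_ortho => U PU.
rewrite -(adjP _ _ bD) -(adjPr _ _ (alg_bounded aP PS)).
have MSD : M (adj S \o D) by apply: alg_comp => //; [exact/PM/vP.1|exact: QM].
rewrite (vector_traceC tM MSD (PM PU)) (adjP _ _ (alg_bounded aP PU)) /=.
rewrite (adjPr _ _ (alg_bounded aP PS)).
have PU' := vP.1 _ PU.
rewrite -(@jones_id _ _ Omega _ aP (S (adj U Omega))); last by apply: L2_mul => //; exact: L2_in.
by rewrite -jones_herm// DO inner0l.
Qed.

(** * The operator [q] attached to two bases *)

Section Bases.
Variables (m n : nat) (lambda : 'I_m -> H -> H) (mu : 'I_n -> H -> H).
Hypothesis basis_lambda : pimsner_popa_basis Omega N P lambda.
Hypothesis basis_mu : pimsner_popa_basis Omega N Q mu.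

(** Only one order of the bases is treated: swapping [P] with [Q] and [lambda] with [mu] gives the
    other operator, up to the order of summation. *)
Definition double_sum : H -> H := \sum_(i < m) \sum_(j < n)
  (mu j \o lambda i \o e_ N \o adj (lambda i) \o adj (mu j)).
Local Notation q := double_sum.

Lemma double_sumE x : q x = \sum_j mu j (e_ P (adj (mu j) x)).
Proof.
have [Pl [E hE lE]] := basis_lambda; have [Qm _] := basis_mu.
rewrite /double_sum fct_sumE.
under eq_bigr do rewrite fct_sumE.
rewrite exchange_big; apply: eq_bigr => j _ /=.
rewrite (basis_jones vN vP NP hE Pl lE) linear_sumE//.
exact: alg_linear aQ (Qm j).
Qed.

Lemma double_sum_herm x y : inner (q x) y = inner x (q y).
Proof.
have [Qm _] := basis_mu; rewrite !double_sumE inner_suml inner_sumr.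
apply: eq_bigr => j _; have bj := alg_bounded aQ (Qm j).
by rewrite (adjP _ _ bj) jones_herm// (adjPr _ _ bj).
Qed.

Lemma double_sum_bounded : bounded_op q.
Proof.
have [Pl _] := basis_lambda; have [Qm _] := basis_mu.
apply: bounded_op_sum => i; apply: bounded_op_sum => j.
apply: bounded_op_comp; last exact: (alg_bounded aQ (vQ.1 _ (Qm j))).
apply: bounded_op_comp; last exact: (alg_bounded aP (vP.1 _ (Pl i))).
apply: bounded_op_comp; last exact: jones_bounded.
by apply: bounded_op_comp; [exact: (alg_bounded aQ)|exact: (alg_bounded aP)].
Qed.

(** In [q^2] the middle factor [e_P mu_k^* mu_j e_P] becomes [E(mu_k^* mu_j) e_P], and the sum over
    [k] rebuilds [mu_j]. *)
Lemma double_sum_projection : (forall y, e_ P (e_ Q y) = e_ N y) ->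
  projection q /\ op_le (e_ P) q.
Proof.
move=> sq; have [Qm [E hE mE]] := basis_mu.
have Qm' j : Q (adj (mu j)) by exact: vQ.1.
have reconstruct T x : Q T -> \sum_j mu j (E (adj (mu j) \o T) x) = T x.
  by move=> QT; rewrite {2}(mE _ QT) fct_sumE.
have qq x : q (q x) = q x.
  rewrite [LHS]double_sumE [q x]double_sumE.
  under eq_bigr => k _.
    have lk : linear (mu k) by exact: alg_linear aQ (Qm k).
    have lk' : linear (adj (mu k)) by exact: alg_linear aQ (Qm' k).
    have lP := (jones_bounded Omega aP).1.
    rewrite linear_sumE// linear_sumE// linear_sumE//.
    under eq_bigr => j _.
      have := jones_compression (adj (mu j) x) hE sq (alg_comp aQ (Qm' k) (Qm j)).
      rewrite /= => ->.
      over.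
    over.
  rewrite exchange_big; apply: eq_bigr => j _ /=.
  exact: reconstruct.
(* The same compression applies to [adj (mu j)] alone, and the basis now reconstructs the
   identity. *)
have qP x : q (e_ P x) = e_ P x.
  rewrite double_sumE -[RHS](reconstruct idfun _ (alg_id aQ)).
  apply: eq_bigr => j _; congr (mu j _).
  exact: jones_compression hE sq (Qm' j).
have Pq x : e_ P (q x) = e_ P x.
  by apply: inner_ext => y; rewrite jones_herm// double_sum_herm qP -jones_herm.
split.
  split; last by apply/funext => x; exact: qq.
  by split; [exact: double_sum_bounded|apply: adj_eq; exact: double_sum_herm].
move=> x; rewrite -[(q - e_ P) x]/(q x - e_ P x).
(* Since [q] fixes the range of [e_ P], the difference [q - e_ P] is again a symmetric
   idempotent. *)
suff -> : inner (q x - e_ P x) x = inner (q x - e_ P x) (q x - e_ P x).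
  exact: inner_ge0.
rewrite innerBr !innerBl.
have -> : inner (q x) (q x) = inner (q x) x by rewrite -double_sum_herm qq.
have -> : inner (e_ P x) (q x) = inner (e_ P x) x.
  by rewrite -double_sum_herm qP.
have -> : inner (q x) (e_ P x) = inner (e_ P x) (e_ P x).
  by rewrite double_sum_herm qP jones_herm// jonesK.
by rewrite subrr subr0.
Qed.

Lemma double_sum_commuting : projection q -> forall y, e_ P (e_ Q y) = e_ N y.
Proof.
move=> [_ /(congr1 (fun f => f Omega)) /= qq].
have [Qm [E hE mE]] := basis_mu.
have bm j := alg_bounded aQ (Qm j).
have Qm' j : Q (adj (mu j)) by exact: vQ.1.
have eNP z := jones_sub Omega aN z aP NP.
have eNQ z := jones_sub Omega aN z aQ NQ.
pose d j := e_ P (adj (mu j) Omega) - e_ N (adj (mu j) Omega).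
have dE j : inner (d j) (d j) =
    inner (e_ P (adj (mu j) Omega)) (adj (mu j) Omega) -
    inner (e_ N (adj (mu j) Omega)) (adj (mu j) Omega).
  rewrite {1}/d innerBl !jones_herm// /d.
  rewrite !linearBE; try exact: (jones_bounded Omega aN).1.
    by rewrite jonesK// jonesK// (eNP _).1 (eNP _).2 subrr inner0r subr0 innerBr.
  exact: (jones_bounded Omega aP).1.
(* The [e_ N] terms sum to [e_ Q] by the basis formula, and [e_ Q] fixes [Omega]. *)
have sum_d : \sum_j inner (d j) (d j) = inner (q Omega) Omega - inner Omega Omega.
  rewrite -[X in _ - inner X _](jones_unit Omega aQ).
  rewrite (basis_jones vN vQ NQ hE Qm mE) double_sumE !inner_suml -sumrB.
  by apply: eq_bigr => j _; rewrite dE !(adjP _ _ (bm j)).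
have q_le : inner (q Omega) Omega - inner Omega Omega <= 0 :> C.
  rewrite -oppr_ge0 opprB.
  have -> : inner Omega Omega - inner (q Omega) Omega =
            inner (Omega - q Omega) (Omega - q Omega).
    rewrite innerBr !innerBl double_sum_herm -[inner (q Omega) (q Omega)]double_sum_herm.
    by rewrite qq double_sum_herm subrr subr0.
  exact: inner_ge0.
have d0 j : d j = 0.
  have sum0 : \sum_j inner (d j) (d j) = 0 :> C.
    apply/eqP; rewrite eq_le sum_d q_le -sum_d /=.
    by apply: sumr_ge0 => k _; exact: inner_ge0.
  apply: inner_eq0; apply: (psumr_eq0P _ sum0) => // k _; exact: inner_ge0.
have eQ T : Q T -> e_ P (T Omega) = e_ N (T Omega).
  move=> QT; have QT' := vQ.1 _ QT.
  (* Taking adjoints in the basis expansion of [adj T] writes [T] as the sum of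
     [nu j \o adj (mu j)]. The coefficients in [N] now stand on the left, where both Jones
     projections commute with them. *)
  pose nu j := adj (E (adj (mu j) \o adj T)).
  have NE j : N (E (adj (mu j) \o adj T)).
    by apply: (ce_in hE); exact: alg_comp.
  have Nnu j : N (nu j) by exact: vN.1.
  have -> : T = fun x => \sum_j nu j (adj (mu j) x).
    rewrite -{1}(adjK (alg_bounded aQ QT) (alg_bounded aQ QT')).
    apply: adj_eq => x y; rewrite {1}(mE _ QT') fct_sumE inner_suml inner_sumr.
    apply: eq_bigr => j _ /=.
    by rewrite (adjP _ _ (bm j)) (adjP _ _ (alg_bounded aN (NE j))).
  rewrite (linear_sumE _ (jones_bounded Omega aP).1).
  rewrite (linear_sumE _ (jones_bounded Omega aN).1).
  apply: eq_bigr => j _; rewrite (jones_mul _ _ vP (NP (Nnu j))).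
  rewrite (jones_mul _ _ vN (Nnu j)); congr (nu j _).
  by apply/eqP; rewrite -subr_eq0; apply/eqP; exact: d0.
(* As [e_N = e_N e_Q], it remains to compare [e_ P] and [e_ N] on [L2 Omega Q]; agreement on
   [Q Omega] suffices by density. *)
move=> y; rewrite -[RHS](eNQ _).1; apply/eqP; rewrite -subr_eq0; apply/eqP.
apply: inner_ext => z; rewrite inner0l innerBl (jones_herm _ aP) (jones_herm _ aN) -innerBr.
move: (e_ Q y) (@jones_in _ _ Omega _ aQ y); apply: L2_ortho => S QS.
by rewrite innerBr -!jones_herm// eQ// subrr.
Qed.

End Bases.
End CommutingSquare.

(** * Angles *)

(* Outside [-1, 1] the value of [acos] is the default 0, which differs from
   pi / 2, so no bound on [x] is required. *)
Lemma acos_eq_pi2 (R : realType) (x : R) : acos x = pi / 2 <-> x = 0.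
Proof.
split=> [|->]; last exact: acos0.
rewrite unlock; case: xgetP => [y _ [_ <-] ->|_ /esym/eqP]; first exact: cos_pihalf.
by rewrite mulf_eq0 invr_eq0 pnatr_eq0 gt_eqF ?pi_gt0.
Qed.

Section Angle.
Context {R : realType} {H : hilbertType R}.
Local Notation C := (R[i]%C).
Implicit Types (x y z u v w : H) (S T U : H -> H).

Section Trace.
Variables (A : set (H -> H)) (tr : (H -> H) -> C).
Hypotheses (aA : op_algebra A) (trA : normalized_trace A tr).

Lemma trace0 : tr 0 = 0.
Proof.
have A0 := alg0 aA; have := trace_linear trA 1 A0 A0.
by rewrite scaler0 addr0 mul1r => /esym/eqP; rewrite -subr_eq0 addrK => /eqP.
Qed.

Lemma traceZ c T : A T -> tr (c *: T) = c * tr T.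
Proof.
by move=> AT; rewrite -[c *: T]addr0 (trace_linear trA _ AT (alg0 aA)) trace0 addr0.
Qed.

End Trace.

Variables (Omega : H) (M N P Q : set (H -> H)) (tr : (H -> H) -> C).
Hypotheses (vM : von_neumann M) (tM : normalized_trace M (vector_state Omega)).
Hypotheses (vN : von_neumann N) (vP : von_neumann P) (vQ : von_neumann Q).
Hypotheses (NP : N `<=` P) (NQ : N `<=` Q) (PM : P `<=` M) (QM : Q `<=` M).
Hypotheses (PN : P <> N) (QN : Q <> N).
Hypothesis trM1 : normalized_trace (basic_construction Omega N M) tr.
Let aN := von_neumann_algebra vN.
Let aP := von_neumann_algebra vP.
Let aQ := von_neumann_algebra vQ.
Let aM := von_neumann_algebra vM.
Local Notation e_ := (jones_proj Omega).
Local Notation M1 := (basic_construction Omega N M).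

Lemma algebra_basic_construction : op_algebra M1.
Proof. exact: algebra_bicommutant. Qed.
Let aM1 := algebra_basic_construction.

(** The basis formula writes [e_ B] as a finite sum of products of [e_ N] and elements of [M]. This
    makes the trace axioms of [tr] available for it. *)
Lemma jones_basic_construction B n (b : 'I_n -> H -> H) :
  von_neumann B -> N `<=` B -> B `<=` M ->
  pimsner_popa_basis Omega N B b -> M1 (e_ B).
Proof.
move=> vB NB BM [Bb [E hE bE]].
have M1e : M1 (e_ N).
  by apply: sub_bicommutant; [exact: jones_bounded|right].
have M1M T : M T -> M1 T.
  by move=> MT; apply: sub_bicommutant; [exact: alg_bounded MT|left].
have -> : e_ B = \sum_i (b i \o e_ N \o adj (b i)).
  by apply/funext => x; rewrite fct_sumE (basis_jones vN vB NB hE Bb bE).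
apply: alg_sum => // i; apply: alg_comp => //; first apply: alg_comp => //.
  exact/M1M/BM.
by apply/M1M/BM; exact: vB.1.
Qed.

(** Ensures that the angle vectors have nonzero norm. If [e_ B = e_ N], then [T Omega = E T Omega]
    for [T] in [B], and since [Omega] is separating, [T = E T] lies in [N]. *)
Lemma jones_proj_neq B n (b : 'I_n -> H -> H) :
  von_neumann B -> N `<=` B -> B `<=` M ->
  pimsner_popa_basis Omega N B b -> B <> N -> e_ B - e_ N <> 0.
Proof.
move=> vB NB BM [Bb [E hE bE]] BN /eqP; rewrite subr_eq0 => /eqP eBN; apply: BN.
have aB := von_neumann_algebra vB.
apply/seteqP; split => // T BT.
have NET := ce_in hE BT.
suff : T - E T = 0 by move/eqP; rewrite subr_eq0 => /eqP ->.
apply: (vector_separating vM tM).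
  by apply: algB => //; [exact: BM|exact/BM/NB].
rewrite -[(T - E T) Omega]/(T Omega - E T Omega).
rewrite -(jones_expectation vN vB NB hE BT) -eBN jones_id ?subrr//.
exact: L2_in.
Qed.

Variables (m n : nat) (lambda : 'I_m -> H -> H) (mu : 'I_n -> H -> H).
Hypothesis basis_lambda : pimsner_popa_basis Omega N P lambda.
Hypothesis basis_mu : pimsner_popa_basis Omega N Q mu.

Lemma trace_norm_neq0 T : M1 T -> T <> 0 -> trace_norm tr T != 0.
Proof.
move=> MT T0; rewrite sqrtC_eq0; apply/eqP => t0; apply: T0.
exact: (trace_faithful trM1).
Qed.

Lemma commuting_squareC :
  (forall y, e_ P (e_ Q y) = e_ N y) <-> (forall y, e_ Q (e_ P y) = e_ N y).
Proof.
by split=> sq y; apply: inner_ext => z; rewrite !jones_herm// sq.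
Qed.

Lemma angle_commuting :
  angle Omega tr N P Q = pi / 2 <-> (forall y, e_ P (e_ Q y) = e_ N y).
Proof.
have M1N : M1 (e_ N) by apply: sub_bicommutant; [exact: jones_bounded|right].
have M1P := jones_basic_construction vP NP PM basis_lambda.
have M1Q := jones_basic_construction vQ NQ QM basis_mu.
pose dP := e_ P - e_ N; pose dQ := e_ Q - e_ N.
have M1dP : M1 dP by exact: algB.
have M1dQ : M1 dQ by exact: algB.
have aP0 := trace_norm_neq0 M1dP (jones_proj_neq vP NP PM basis_lambda PN).
have aQ0 := trace_norm_neq0 M1dQ (jones_proj_neq vQ NQ QM basis_mu QN).
have eNP z := jones_sub Omega aN z aP NP.
have eNQ z := jones_sub Omega aN z aQ NQ.
have dE B y : (e_ B - e_ N) y = e_ B y - e_ N y by [].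
have dherm B : op_algebra B ->
    forall y z, inner ((e_ B - e_ N) y) z = inner y ((e_ B - e_ N) z).
  by move=> aB y z; rewrite !dE innerBl innerBr !jones_herm.
have XE y : dQ (dP y) = e_ Q (e_ P y) - e_ N y.
  rewrite /dQ /dP !dE !(linearBE _ _ (jones_bounded Omega _).1)//.
  by rewrite (eNQ _).2 (eNP _).1 jonesK// subrr subr0.
have dPP : dP \o dP = dP.
  apply/funext => y; rewrite /= /dP !dE !(linearBE _ _ (jones_bounded Omega _).1)//.
  by rewrite (eNP _).2 (eNP _).1 !jonesK// subrr subr0.
have dQQ : dQ \o dQ = dQ.
  apply/funext => y; rewrite /= /dQ !dE !(linearBE _ _ (jones_bounded Omega _).1)//.
  by rewrite (eNQ _).2 (eNQ _).1 !jonesK// subrr subr0.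
pose X := dQ \o dP.
have M1X : M1 X by exact: alg_comp.
have adjX : adj X = dP \o dQ.
  by apply: adj_eq => y z /=; rewrite !dherm.
(* Both [dP] and [dQ] are idempotent, so this is the cyclicity of the trace; it brings the inner
   product into a form to which positivity and faithfulness apply. *)
have trX : tr (dQ \o dP) = tr (adj X \o X).
  rewrite adjX -compA (compA dQ dQ dP) dQQ -[in LHS]dPP compA.
  by rewrite (trace_comm trM1 (alg_comp aM1 M1dQ M1dP) M1dP).
have trX0 : tr (dQ \o dP) = 0 <-> (forall y, e_ P (e_ Q y) = e_ N y).
  rewrite commuting_squareC trX; split=> [/(trace_faithful trM1 M1X) X0 y|sq].
    by apply/eqP; rewrite -subr_eq0 -XE -[dQ _]/(X y) X0.
  have -> : adj X \o X = 0.
    apply/funext => y; rewrite adjX -[LHS]/((dP \o dQ) (dQ (dP y))) XE sq subrr.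
    exact: linear0E (alg_linear aM1 (alg_comp aM1 M1dP M1dQ)).
  exact: trace0 aM1 trM1.
rewrite /angle acos_eq_pi2 -trX0 /trace_inner /angle_vector -/dP -/dQ.
set a := trace_norm tr dP; set b := trace_norm tr dQ.
have b_ge0 : 0 <= b by rewrite sqrtC_ge0; exact: (trace_pos trM1).
have a_ge0 : 0 <= a by rewrite sqrtC_ge0; exact: (trace_pos trM1).
have -> : adj (b^-1 *: dQ) = b^-1 *: dQ.
  apply: adj_eq => y z; rewrite -![(b^-1 *: dQ) _]/(b^-1 *: dQ _).
  by rewrite innerZl innerZr dherm// geC0_conj ?invr_ge0.
have -> : (b^-1 *: dQ) \o (a^-1 *: dP) = (b^-1 * a^-1) *: (dQ \o dP).
  apply/funext => y; rewrite -[LHS]/(b^-1 *: dQ (a^-1 *: dP y)).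
  by rewrite (linearZE _ _ (alg_linear aM1 M1dQ)) scalerA.
rewrite (traceZ aM1 trM1)//; set t := tr _.
have t_ge0 : 0 <= t by rewrite /t trX; exact: (trace_pos trM1).
have s_ge0 : 0 <= b^-1 * a^-1 * t by rewrite !mulr_ge0 ?invr_ge0.
(* The scaled trace is nonnegative, hence real, so its vanishing real part forces it to be 0. *)
split=> [re0|->]; last by rewrite mulr0.
have /eqP : b^-1 * a^-1 * t = 0 by rewrite -[LHS]RRe_real ?ger0_real// re0.
by rewrite !mulf_eq0 !invr_eq0 (negPf aP0) (negPf aQ0) => /eqP.
Qed.

End Angle.

Theorem proposition3p21 (R : realType) (H : hilbertType R) (Omega : H)
    (N M P Q : set (H -> H)) (tr : (H -> H) -> R[i]%C)
    (m n : nat) (lambda : 'I_m -> H -> H) (mu : 'I_n -> H -> H) :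
  II1_factor M -> standard_form M Omega ->
  II1_factor N -> N `<=` M -> (jones_index Omega N < +oo)%E ->
  normalized_trace (basic_construction Omega N M) tr ->
  intermediate_subfactor N M P -> intermediate_subfactor N M Q ->
  P <> N -> Q <> N ->
  pimsner_popa_basis Omega N P lambda ->
  pimsner_popa_basis Omega N Q mu ->
  let e1 := jones_proj Omega N in
  let q := \sum_(i < m) \sum_(j < n)
    (mu j \o lambda i \o e1 \o adj (lambda i) \o adj (mu j)) in
  let p := \sum_(i < m) \sum_(j < n)
    (lambda i \o mu j \o e1 \o adj (mu j) \o adj (lambda i)) in
  [<-> angle Omega tr N P Q = pi / 2;
       projection q /\ op_le (jones_proj Omega P) q;
       projection p /\ op_le (jones_proj Omega Q) p].
Proof.
move=> [vM _ _ _] [tM _] [vN _ _ _] _ _ trM1 [vP _ NP PM] [vQ _ NQ QM] PN QN.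
move=> bl bm e1 q p.
have angleE := angle_commuting vM tM vN vP vQ NP NQ PM QM PN QN trM1 bl bm.
have sqC := commuting_squareC Omega vN vP vQ.
have pE : p = double_sum Omega N mu lambda by rewrite /p exchange_big.
(* The implications are proved in a cycle; the last two pass through the commuting square, whose
   symmetry in [P] and [Q] is [sqC]. *)
tfae.
- move=> /angleE; exact: (double_sum_projection vM tM).
- move=> [qq _]; rewrite pE.
  apply: (double_sum_projection vM tM vN vQ vP NQ NP QM PM bm bl).
  by apply/sqC; exact: (double_sum_commuting vN vP vQ NP NQ bl bm).
- rewrite pE => -[pp _]; apply/angleE/sqC.
  exact: (double_sum_commuting vN vQ vP NQ NP bm bl).
Qed.
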